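(* Let $t$ be a positive integer and $C\ge 4t^{1/2}$ a real number. Let $\mathcal{G} = \{G_1, \ldots, G_t\}$ be a family of $(n,D,\lambda)$-graphs on the same vertex set $V(\mathcal{G})$. Let $S \subseteq V(\mathcal{G})$ with $|S| = C \frac{n\lambda}{D}$. Then there is a subset $W \subseteq S$ with $|W| \geq (1-8tC^{-2})|S|$ such that $\delta(G_r[W]) \geq 4^{-1}C\lambda$ for each $r\in [t]$.
   Context: Graphs are finite and simple. A graph $G$ is an $(n,D,\lambda)$-graph if it is a $D$-regular graph on $n$ vertices and all but at most one of the eigenvalues of its adjacency matrix (counted with multiplicity) are bounded in absolute value by $\lambda$; here $D>0$, so that $n\lambda/D$ is defined. All graphs of the family have the same parameters $n,D,\lambda$. $[t]=\{1,\ldots,t\}$. $G[W]$ is the subgraph of $G$ induced by $W$, and $\delta(H)$ is the minimum degree of $H$. *)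

(* Defs.v *)
From HB Require Import structures.
From mathcomp Require Import all_boot all_order all_algebra.
From mathcomp Require Import all_reals.

Set Implicit Arguments.
Unset Strict Implicit.
Unset Printing Implicit Defensive.

Import Order.TTheory GRing.Theory Num.Theory.
Local Open Scope ring_scope.

Record sgraph (V : finType) := SGraph {
  edge :> rel V;
  edge_sym : symmetric edge;
  edge_irr : irreflexive edge }.

Definition degree (V : finType) (G : sgraph V) (v : V) : nat :=
  #|[set u | G v u]|.

Definition regular (V : finType) (D : nat) (G : sgraph V) : Prop :=
  forall v, degree G v = D.

Definition induced (V : finType) (G : sgraph V) (W : {set V}) :
    sgraph {v : V | v \in W} :=
  SGraph (edge := fun u v => G (val u) (val v))
    (fun u v => edge_sym G (val u) (val v))
    (fun v => edge_irr G (val v)).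

(* Extended-real valued so that the graph without vertices has the minimum    *)
(* over the empty set, [+oo]; on every other graph this is the least degree.  *)
Definition min_degree (R : realType) (V : finType) (G : sgraph V) : \bar R :=
  \big[Order.min/+oo%E]_(v : V) ((degree G v)%:R)%:E.

Definition adjacency (R : realType) (V : finType) (G : sgraph V) : 'M[R]_#|V| :=
  \matrix_(i < #|V|, j < #|V|) (G (enum_val i) (enum_val j))%:R.

(* [s] lists the eigenvalues of [A] with algebraic multiplicity; a real       *)
(* symmetric matrix has such an [s], unique up to permutation.                *)
Definition eigenvalues (R : realType) (n : nat) (A : 'M[R]_n) (s : seq R) :
    Prop :=
  char_poly A = \prod_(a <- s) ('X - a%:P).

Definition ndl_graph (R : realType) (V : finType) (n D : nat) (lambda : R)
    (G : sgraph V) : Prop :=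
  [/\ #|V| = n, (0 < D)%N, regular D G
    & exists2 s : seq R, eigenvalues (adjacency R G) s
        & (count (fun a : R => ~~ (`|a| <= lambda)%R) s <= 1)%N].

(* Main.v *)
Require Import Defs.
From HB Require Import structures.
From mathcomp Require Import all_boot all_order all_algebra.
From mathcomp Require Import all_reals.
From mathcomp Require Import complex ring lra.

(** Write [q] for [#|W| / #|S|] and call a vertex low for [W] if in some colour
    it has fewer than [C * lambda / 4] neighbours in [W].  Lowness is inherited
    by smaller sets, so deleting low vertices from [S] one by one leaves each
    deleted vertex low for the current set.  Stop just before the size would
    drop below [(1 - x0) * #|S|] with [x0 = 8 * t / C ^ 2] (lemma [peeling]).
    If [W] still has a low vertex, adjoin it to the deleted ones: the resulting
    set [Y] has more than [x0 * #|S|] elements, all low for [W], and [W] still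
    has at least [(1 - x0) * #|S|] elements.  Keeping this last vertex in both
    [Y] and [W] avoids all rounding losses, and the mixing lemma allows the sets
    to overlap.

    By the size of [S], a typical vertex has [C * lambda * q] neighbours in [W],
    and [q >= 1/2] because [C ^ 2 >= 16 * t].  The expander mixing lemma, used
    in the form [low_degree_card], says that the set [X_r] of vertices of [Y]
    low in colour [r] satisfies [C ^ 2 * (q - 1/4) ^ 2 * #|X_r| <= #|W|].  Summing over
    the colours and using [#|Y| > x0 * #|S|] gives [8 * (q - 1/4) ^ 2 < q], that
    is [(q - 1/2) * (q - 1/8) < 0], which is absurd for [q >= 1/2].

    The mixing lemma rests on the spectral theorem.  For nonempty [S], the
    bound [#|S| <= n] forces [lambda < D], so the eigenvalue [D] of the constant
    vector is the single exceptional one, and the adjacency matrix multiplies the norm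
    of every vector orthogonal to the constants by at most [lambda]
    ([symmetric_gap], [ndl_graph_gap]). *)

Set Implicit Arguments.
Unset Strict Implicit.
Unset Printing Implicit Defensive.

Import Order.TTheory GRing.Theory Num.Theory.
Local Open Scope ring_scope.

(** * Norm contraction orthogonally to an eigenvector *)

Local Open Scope sesquilinear_scope.

Lemma char_poly_conj (K : fieldType) n (P A : 'M[K]_n) :
  P \in unitmx -> char_poly (invmx P *m A *m P) = char_poly A.
Proof.
move=> uP; rewrite /char_poly.
have -> : char_poly_mx (invmx P *m A *m P) =
    map_mx polyC (invmx P) *m char_poly_mx A *m map_mx polyC P.
  rewrite /char_poly_mx !map_mxM mulmxBr mulmxBl; congr (_ - _).
  by rewrite scalar_mxC -mulmxA -map_mxM mulVmx // map_mx1 mulmx1.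
rewrite !det_mulmx mulrAC -det_mulmx -map_mxM mulVmx //.
by rewrite map_mx1 det1 mul1r.
Qed.

Lemma unitary_isometry (K : numClosedFieldType) n (P : 'M[K]_n) (x : 'rV_n) :
  P \is unitarymx ->
  \sum_i `|(x *m P^t*) 0 i| ^+ 2 = \sum_i `|x 0 i| ^+ 2.
Proof.
move=> uP.
have dotE (y : 'rV[K]_n) : \sum_i `|y 0 i| ^+ 2 = (y *m y^t*) 0 0.
  by rewrite mxE; apply: eq_bigr => i _; rewrite !mxE normCK.
rewrite !dotE trmx_mul map_mxM trmxCK mulmxA -(mulmxA x).
by rewrite -(invmx_unitary uP) mulVmx ?unitarymx_unit // mulmx1.
Qed.

Lemma count_le1_inj (I : finType) (p : pred I) (i j : I) :
  (count p (enum I) <= 1)%N -> p i -> p j -> i = j.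
Proof.
rewrite -size_filter => sz pi pj.
have : i \in filter p (enum I) by rewrite mem_filter pi mem_enum.
have : j \in filter p (enum I) by rewrite mem_filter pj mem_enum.
by case: filter sz => [|a [|b s]] //= _; rewrite !inE => /eqP-> /eqP->.
Qed.

(** In an orthonormal eigenbasis, [v] can only have a coordinate where the
    eigenvalue is [mu], hence only at the single index whose eigenvalue exceeds
    [lambda]; a vector orthogonal to [v] has coordinate 0 there, and every other
    coordinate is scaled by at most [lambda]. *)
Lemma normal_gap (K : numClosedFieldType) n (A : 'M[K]_n) (s : seq K)
    (lambda mu : K) (v x : 'rV_n) :
  A \is normalmx -> char_poly A = \prod_(a <- s) ('X - a%:P) ->
  (count (fun a => ~~ (`|a| <= lambda)%R) s <= 1)%N ->
  ~~ (`|mu| <= lambda) -> v != 0 -> v *m A = mu *: v -> x *m v^t* = 0 ->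
  \sum_i `|(x *m A) 0 i| ^+ 2 <= lambda ^+ 2 * \sum_i `|x 0 i| ^+ 2.
Proof.
move=> /orthomx_spectralP; set P := spectralmx A; set d := spectral_diag A.
move=> AE chA cnt mu_big v0 vA xv.
have uP : P \is unitarymx by exact: spectral_unitarymx.
have Pu : P \in unitmx by exact: unitarymx_unit.
have VP : invmx P = P^t* by exact: invmx_unitary.
(* The given spectrum and the diagonal [d] are the roots of one polynomial. *)
have dcount : (count (fun i => ~~ (`|d 0 i| <= lambda)%R) (enum 'I_n) <= 1)%N.
  suff /permP E : perm_eq [seq d 0 i | i <- enum 'I_n] s.
    by move: cnt; rewrite -E count_map.
  apply: prod_XsubC_eq.
  rewrite -chA AE char_poly_conj // char_poly_trig ?diag_mx_is_trig //.
  rewrite big_map big_enum /=; apply: eq_bigr => i _.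
  by rewrite mxE eqxx mulr1n.
set y := x *m P^t*; set z := v *m P^t*.
have zd i : z 0 i * (d 0 i - mu) = 0.
  have /rowP/(_ i) : z *m diag_mx d = mu *: z.
    rewrite /z scalemxAl -vA AE VP !mulmxA -[in RHS]mulmxA.
    by rewrite (unitarymxP uP) mulmx1.
  by rewrite mul_mx_diag !mxE => E; rewrite mulrBr E mulrC subrr.
have [i0 zi0] : exists i0, z 0 i0 != 0.
  apply/existsP; apply: contraNT v0; rewrite negb_exists => /forallP z0.
  have zE : z = 0 
    by apply/rowP => i; rewrite [RHS]mxE; apply/eqP; rewrite -[_ == _]negbK.
  by rewrite -[v]mulmx1 -(mulVmx Pu) VP mulmxA -/z zE mul0mx.
have di0 : d 0 i0 = mu.
  apply/eqP; rewrite -subr_eq0; move/eqP: (zd i0).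
  by rewrite mulf_eq0 (negPf zi0).
have dsmall i : i != i0 -> `|d 0 i| <= lambda.
  move=> ii0; apply: contraNT ii0 => di; apply/eqP.
  by apply: count_le1_inj dcount di _; rewrite di0.
have z0 i : i != i0 -> z 0 i = 0.
  move=> /dsmall di; move/eqP: (zd i); rewrite mulf_eq0 => /orP[/eqP//|].
  by rewrite subr_eq0 => /eqP dE; move: mu_big; rewrite -dE di.
have yi0 : y 0 i0 = 0.
  have : (y *m z^t*) 0 0 = 0.
    rewrite /y /z trmx_mul map_mxM trmxCK mulmxA -(mulmxA x).
    by rewrite -VP mulVmx // mulmx1 xv mxE.
  have ztE i : (z^t*) i 0 = (z 0 i)^* by rewrite [LHS]mxE [z^T _ _]mxE.
  rewrite mxE (bigD1 i0) //= big1 => [|i ii0]; last first.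
    by rewrite ztE z0 // conjC0 mulr0.
  rewrite addr0 ztE => /eqP; rewrite mulf_eq0 conjC_eq0 => /orP[/eqP//|].
  by rewrite (negPf zi0).
have -> : \sum_i `|(x *m A) 0 i| ^+ 2 = \sum_i `|(y *m diag_mx d) 0 i| ^+ 2.
  rewrite -(unitary_isometry (x *m A) uP) AE -VP !mulmxA mulmxK //.
  by rewrite /y VP.
rewrite -(unitary_isometry x uP) -/y mulr_sumr; apply: ler_sum => i _.
rewrite mul_mx_diag mxE normrM exprMn mulrC.
have [->|ii0] := eqVneq i i0; first by rewrite yi0 normr0 expr0n !mulr0.
apply: ler_wpM2r; first exact: exprn_ge0.
by rewrite lerXn2r ?nnegrE ?(le_trans _ (dsmall i ii0)) ?dsmall.
Qed.

(** The diagonalisation lives over a closed field, so the real statement is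
    obtained by embedding [R] in [R[i]]. *)
Lemma symmetric_gap (R : rcfType) n (A : 'M[R]_n) (s : seq R)
    (lambda mu : R) (v x : 'rV_n) :
  A^T = A -> char_poly A = \prod_(a <- s) ('X - a%:P) ->
  (count (fun a => ~~ (`|a| <= lambda)%R) s <= 1)%N ->
  ~~ (`|mu| <= lambda) -> v != 0 -> v *m A = mu *: v -> x *m v^T = 0 ->
  \sum_i (x *m A) 0 i ^+ 2 <= lambda ^+ 2 * \sum_i x 0 i ^+ 2.
Proof.
move=> Asym chA cnt mu_big v0 vA xv.
pose f : {rmorphism R -> R[i]} := real_complex R.
have fle a b : (f a <= f b) = (a <= b) by exact: lecR.
have fconj a : (f a)^* = f a by apply/CrealP/complex_realP; exists a.
have fnorm a : `|f a| = f `|a| by rewrite normc_def /= expr0n addr0 sqrtr_sqr.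
have sumE (w : 'rV[R]_n) :
    \sum_i `|(map_mx f w) 0 i| ^+ 2 = f (\sum_i w 0 i ^+ 2).
  rewrite rmorph_sum; apply: eq_bigr => i _.
  by rewrite mxE fnorm -rmorphXn /= real_normK ?num_real.
rewrite -fle rmorphM rmorphXn /= -!sumE map_mxM.
apply: (@normal_gap _ _ _ [seq f a | a <- s] _ (f mu) (map_mx f v)).
- apply: symmetric_normalmx; last first.
    by apply/mxOverP => i j; rewrite mxE; apply/complex_realP; exists (A i j).
  by apply/is_hermitianmxP; rewrite expr0 scale1r; apply/matrixP => i j;
    rewrite !mxE -[in LHS]Asym mxE.
- rewrite -map_char_poly chA rmorph_prod big_map; apply: eq_bigr => a _.
  by rewrite rmorphB /= map_polyX map_polyC.
- rewrite count_map; apply: leq_trans cnt; apply: sub_count => a /=.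
  by rewrite fnorm fle.
- by rewrite fnorm fle.
- by rewrite map_mx_eq0.
- by rewrite -map_mxM vA map_mxZ.
- have -> : (map_mx f v)^t* = map_mx f v^T.
    by apply/matrixP => i j; rewrite !mxE fconj.
  by rewrite -map_mxM xv map_mx0.
Qed.

Local Close Scope sesquilinear_scope.

(** * Degrees into a set of vertices *)

Definition degree_in (V : finType) (G : sgraph V) (W : {set V}) (v : V) : nat :=
  #|[set u in W | G v u]|.

Lemma degree_inE (R : realType) (V : finType) (G : sgraph V) (W : {set V}) v :
  (degree_in G W v)%:R = \sum_(u in W) (G v u)%:R :> R.
Proof.
rewrite -natr_sum; congr _%:R; rewrite /degree_in -sum1dep_card big_mkcondr /=.
by apply: eq_bigr => u _; case: (G v u).
Qed.

Lemma degree_in_setT (V : finType) (G : sgraph V) v :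
  degree_in G [set: V] v = degree G v.
Proof. by congr #|pred_of_set _|; apply/setP => u; rewrite !inE. Qed.

Lemma degree_in_subset (V : finType) (G : sgraph V) (A B : {set V}) v :
  A \subset B -> (degree_in G A v <= degree_in G B v)%N.
Proof.
move=> /subsetP AB; apply/subset_leq_card/subsetP => u.
by rewrite !inE => /andP[/AB-> ->].
Qed.

(** Replaces the graph on a subtype by a count in the ambient vertex set, where
    [W] can vary. *)
Lemma degree_induced (V : finType) (G : sgraph V) (W : {set V})
    (v : {v : V | v \in W}) :
  degree (induced G W) v = degree_in G W (val v).
Proof.
rewrite /degree /degree_in -(card_imset _ val_inj); congr #|pred_of_set _|.
apply/setP => u; rewrite !inE; apply/imsetP/andP => [[w]|[uW Gvu]].
  by rewrite inE => Gvw ->; split; [exact: valP|].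
by exists (exist _ u uW); rewrite ?inE.
Qed.

(** * The expander mixing lemma *)

(** The constant vector is an eigenvector for [D], and the sum condition on [f]
    is orthogonality to it. *)
Lemma ndl_graph_gap (R : realType) (V : finType) (n D : nat) (lambda : R)
    (G : sgraph V) (f : V -> R) :
  ndl_graph n D lambda G -> lambda < D%:R -> \sum_v f v = 0 ->
  \sum_u (\sum_v f v * (G v u)%:R) ^+ 2 <= lambda ^+ 2 * \sum_v f v ^+ 2.
Proof.
move=> [_ _ regG [s chA cnt]] lamD f0.
have [v0 _|V0] := pickP (xpredT : pred V); last first.
  by rewrite !(eq_bigl _ _ V0) !big_pred0_eq mulr0.
have sumE (F : V -> R) : \sum_v F v = \sum_(i < #|V|) F (enum_val i).
  exact: (big_enum_val (A := V)).
pose x : 'rV[R]_#|V| := \row_i f (enum_val i).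
have xA i : (x *m adjacency R G) 0 i = \sum_v f v * (G v (enum_val i))%:R.
  by rewrite mxE sumE; apply: eq_bigr => j _; rewrite !mxE.
have xE i : x 0 i = f (enum_val i) by rewrite mxE.
rewrite sumE [X in _ <= _ * X]sumE.
under eq_bigr => i _ do rewrite -xA.
under [X in _ <= _ * X]eq_bigr => i _ do rewrite -xE.
apply: (@symmetric_gap _ _ _ s _ D%:R (const_mx 1)) => //.
- by apply/matrixP => i j; rewrite !mxE edge_sym.
- by rewrite normr_nat -ltNge.
- apply/eqP => /rowP/(_ (enum_rank v0)); rewrite !mxE => /eqP.
  by rewrite oner_eq0.
- apply/rowP => i; rewrite !mxE mulr1 -(regG (enum_val i)).
  rewrite -degree_in_setT degree_inE.
  under [RHS]eq_bigl do rewrite inE.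
  by rewrite sumE; apply: eq_bigr => j _; rewrite !mxE mul1r edge_sym.
- apply/rowP => i; rewrite [RHS]mxE -[RHS]f0 sumE mxE.
  by apply: eq_bigr => j _; rewrite !mxE mulr1.
Qed.

(** With [k] the size of [W] and [m] the sum of [a] over [W], the sum of the
    squares [(k * a u - m) ^+ 2] is nonnegative and equals [k] times the
    difference of the two sides. *)
Lemma sqr_sum_le (R : realFieldType) (T : finType) (W : {set T}) (a : T -> R) :
  (\sum_(u in W) a u) ^+ 2 <= #|W|%:R * \sum_(u in W) a u ^+ 2.
Proof.
have [->|W0] := eqVneq W set0; first by rewrite !big_set0 expr0n mulr0.
have k0 : 0 < #|W|%:R :> R by rewrite ltr0n card_gt0.
set k : R := #|W|%:R in k0 *; set m := \sum_(u in W) a u.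
have : 0 <= \sum_(u in W) (k * a u - m) ^+ 2.
  by apply: sumr_ge0 => u _; exact: sqr_ge0.
have -> : \sum_(u in W) (k * a u - m) ^+ 2 =
    \sum_(u in W) (k ^+ 2 * a u ^+ 2 - 2 * k * m * a u + m ^+ 2).
  by apply: eq_bigr => u _; ring.
rewrite big_split sumrB /= sumr_const -/k -!mulr_sumr -/m -mulr_natl -/k => H.
suff : 0 <= k * (k * \sum_(u in W) a u ^+ 2 - m ^+ 2).
  by rewrite pmulr_rge0 // subr_ge0.
by apply: le_trans H _; rewrite le_eqVlt; apply/orP; left; apply/eqP; ring.
Qed.

(** Apply the spectral gap to the indicator of [X] minus its mean: its image at
    [u] is the number of neighbours of [u] in [X] minus [D * #|X| / n], so
    summing over [W] gives the discrepancy, and Cauchy-Schwarz on [W] concludes.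
    Squares replace the usual absolute value and square root. *)
Lemma expander_mixing (R : realType) (V : finType) (n D : nat) (lambda : R)
    (G : sgraph V) (X W : {set V}) :
  ndl_graph n D lambda G -> lambda < D%:R ->
  (\sum_(v in X) (degree_in G W v)%:R - D%:R * #|X|%:R * #|W|%:R / n%:R) ^+ 2
    <= lambda ^+ 2 * #|X|%:R * #|W|%:R.
Proof.
move=> ndlG lamD; have [cardV _ regG _] := ndlG.
have [X0|X0] := eqVneq X set0.
  by rewrite X0 big_set0 cards0 !(mulr0, mul0r) subr0 expr0n.
have n0 : n%:R != 0 :> R.
  rewrite pnatr_eq0 -cardV -lt0n.
  by have /set0Pn[v _] := X0; apply/card_gt0P; exists v.
set x : R := #|X|%:R; set w : R := #|W|%:R.
pose f v : R := (v \in X)%:R - x / n%:R.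
have indE (Y : {set V}) : \sum_v (v \in Y)%:R = #|Y|%:R :> R.
  rewrite -sum1_card natr_sum [RHS]big_mkcond.
  by apply: eq_bigr => v _; case: ifP.
have sumc (c : R) : \sum_(v : V) c = c * n%:R.
  by rewrite sumr_const -cardV mulr_natr.
have f0 : \sum_v f v = 0.
  by rewrite sumrB indE sumc divfK // subrr.
have f2 : \sum_v f v ^+ 2 <= x.
  have -> : \sum_v f v ^+ 2 = \sum_v ((v \in X)%:R * (1 - 2 * (x / n%:R))
                               + (x / n%:R) ^+ 2).
    by apply: eq_bigr => v _; rewrite /f; case: (v \in X) => /=; ring.
  rewrite big_split /= sumc -mulr_suml indE -/x.
  have -> : x * (1 - 2 * (x / n%:R)) + (x / n%:R) ^+ 2 * n%:R =
      x - x ^+ 2 / n%:R.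
    by field.
  by rewrite gerBl divr_ge0 // sqr_ge0.
have fG u : \sum_v f v * (G v u)%:R =
    \sum_(v in X) (G v u)%:R - D%:R * x / n%:R.
  under eq_bigr => v _ do rewrite mulrBl.
  rewrite sumrB -mulr_sumr -(regG u) -degree_in_setT degree_inE.
  congr (_ - _).
    by rewrite [RHS]big_mkcond; apply: eq_bigr => v _; case: ifP;
      rewrite ?mul1r ?mul0r.
  rewrite mulrC -mulrA; congr (_ * _).
  by apply: eq_big => v; rewrite ?inE // edge_sym.
have -> : \sum_(v in X) (degree_in G W v)%:R - D%:R * x * w / n%:R =
    \sum_(u in W) \sum_v f v * (G v u)%:R.
  under [RHS]eq_bigr => u _ do rewrite fG.
  rewrite sumrB sumr_const -[_ *+ #|W|]mulr_natr -/w exchange_big /=.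
  congr (_ - _); last by rewrite mulrAC.
  by apply: eq_bigr => v _; rewrite degree_inE.
apply: le_trans (sqr_sum_le _ _) _; rewrite -/w mulrC.
apply: ler_wpM2r; first exact: ler0n.
apply: le_trans (_ : \sum_u (\sum_v f v * (G v u)%:R) ^+ 2 <= _).
  rewrite [leRHS](bigID (mem W)) /= lerDl.
  by apply: sumr_ge0 => u _; exact: sqr_ge0.
apply: le_trans (ndl_graph_gap ndlG lamD f0) _.
by apply: ler_wpM2l => //; exact: sqr_ge0.
Qed.

(** * Deleting vertices of low degree *)

(** The vertices of [X] together miss at least
    [(D * #|W| / n - theta) * #|X|] of the expected edges to [W], and the mixing
    lemma bounds the square of this deficit. *)
Lemma low_degree_card (R : realType) (V : finType) (n D : nat)
    (lambda theta : R) (G : sgraph V) (X W : {set V}) :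
  ndl_graph n D lambda G -> lambda < D%:R ->
  {in X, forall v, (degree_in G W v)%:R <= theta} ->
  theta <= D%:R * #|W|%:R / n%:R ->
  (D%:R * #|W|%:R / n%:R - theta) ^+ 2 * #|X|%:R <= lambda ^+ 2 * #|W|%:R.
Proof.
move=> ndlG lamD lowX theta_le.
have [->|X0] := eqVneq X set0.
  by rewrite cards0 mulr0 mulr_ge0 // sqr_ge0.
have x0 : 0 < #|X|%:R :> R by rewrite ltr0n card_gt0.
have e_le : \sum_(v in X) (degree_in G W v)%:R <= theta * #|X|%:R.
  by rewrite mulr_natr -sumr_const; exact: ler_sum.
have := expander_mixing X W ndlG lamD.
set e := \sum_(v in X) _ in e_le *; set x : R := #|X|%:R in e_le x0 *.
set w : R := #|W|%:R in theta_le * => mix.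
have lo : 0 <= (D%:R * w / n%:R - theta) * x.
  by rewrite mulr_ge0 ?subr_ge0 // ltW.
have hi : (D%:R * w / n%:R - theta) * x <= D%:R * x * w / n%:R - e.
  have -> : D%:R * x * w / n%:R = D%:R * w / n%:R * x by ring.
  by rewrite mulrBl lerD2l lerN2.
rewrite -(ler_pM2r x0) [leRHS]mulrAC.
rewrite [leLHS](_ : _ = ((D%:R * w / n%:R - theta) * x) ^+ 2); last by ring.
apply: le_trans mix; rewrite -[leRHS]sqrrN opprB.
by rewrite lerXn2r ?nnegrE // (le_trans lo hi).
Qed.

(** Take [W] of least size among the large subsets of [S] outside of which every
    vertex of [S] is bad for [W].  Deleting a bad vertex of [W] would preserve
    the last property, so it must destroy largeness. *)
Lemma peeling (V : finType) (S : {set V}) (bad : {set V} -> pred V)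
    (large : pred {set V}) :
  (forall (A B : {set V}) v, A \subset B -> bad B v -> bad A v) -> large S ->
  exists W : {set V},
    [/\ W \subset S, large W, {in S :\: W, forall v, bad W v}
      & {in W, forall v, bad W v -> ~~ large (W :\ v)}].
Proof.
move=> bad_anti largeS.
pose P (W : {set V}) :=
  [&& W \subset S, large W & [forall v in S :\: W, bad W v]].
have PS : P S.
  rewrite /P subxx largeS; apply/forall_inP => v.
  by rewrite setDv inE.
case: (arg_minnP (fun W : {set V} => #|W|) PS) => W.
move=> /and3P[WS largeW /forall_inP badW] minW.
exists W; split=> // v vW bad_v; apply/negP => large'.
have /minW : P (W :\ v).
  rewrite /P large' (subset_trans (subD1set _ _)) //; apply/forall_inP => u.
  rewrite !inE negb_and negbK => /andP[/orP[/eqP->|uW] uS].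
    exact: bad_anti (subD1set _ _) bad_v.
  by apply: bad_anti (subD1set _ _) (badW _ _); rewrite inE uW.
by rewrite (cardsD1 v W) vW ltnn.
Qed.

Lemma cover_card (I T : finType) (X : {set T}) (F : I -> {set T}) :
  (forall v, v \in X -> exists i, v \in F i) ->
  (#|X| <= \sum_i #|F i|)%N.
Proof.
move=> cov; apply: leq_trans (_ : #|\bigcup_i F i| <= _)%N.
  apply/subset_leq_card/subsetP => v vX; have [i vF] := cov v vX.
  by apply/bigcupP; exists i.
elim/big_rec2: _ => [|i k A _ le_k]; first by rewrite cards0.
by apply: leq_trans (leq_card_setU _ _).1 _; rewrite leq_add2l.
Qed.

Theorem lemma7 (R : realType) (t : nat) (C : R) (n D : nat) (lambda : R)
    (V : finType) (G : 'I_t -> sgraph V) (S : {set V})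
    (t_gt0 : (0 < t)%N)
    (C_ge : 4 * Num.sqrt t%:R <= C)
    (G_ndl : forall r, ndl_graph n D lambda (G r))
    (S_card : #|S|%:R = C * (n%:R * lambda / D%:R)) :
  exists W : {set V},
    [/\ W \subset S,
        (1 - 8 * t%:R * C ^- 2) * #|S|%:R <= #|W|%:R :> R
      & forall r : 'I_t,
          ((4^-1 * C * lambda)%:E <= min_degree R (induced (G r) W))%E].
Proof.
have [cardV D_gt0 _ _] := G_ndl (Ordinal t_gt0).
have D0 : 0 < D%:R :> R by rewrite ltr0n.
have t1 : 1 <= t%:R :> R by rewrite ler1n.
have C2 : 16 * t%:R <= C ^+ 2.
  have r0 := sqrtr_ge0 (t%:R : R).
  have := sqr_sqrtr (ler0n R t); rewrite expr2.
  by move: C_ge r0; nra.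
have C4 : 4 <= C.
  have : 1 <= Num.sqrt t%:R :> R by rewrite -[leLHS]sqrtr1 ler_wsqrtr.
  by move: C_ge; lra.
have C0 : 0 < C by lra.
set x0 := 8 * t%:R * C ^- 2; set theta := 4^-1 * C * lambda.
have x0E : x0 * C ^+ 2 = 8 * t%:R by rewrite /x0 divfK // gt_eqF // exprn_gt0.
have C20 : 0 < C ^+ 2 by rewrite exprn_gt0.
have x0_ge0 : 0 <= x0 by rewrite divr_ge0 ?mulr_ge0 // ltW.
have x0_le : x0 <= 2^-1 by rewrite -(ler_pM2r C20) x0E; lra.
pose bad (W : {set V}) v := [exists r, (degree_in (G r) W v)%:R < theta].
pose large (W : {set V}) := (1 - x0) * #|S|%:R <= #|W|%:R.
have bad_anti (A B : {set V}) v : A \subset B -> bad B v -> bad A v.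
  move=> AB /existsP[r lowB]; apply/existsP; exists r; apply: le_lt_trans lowB.
  by rewrite ler_nat degree_in_subset.
have largeS : large S.
  by rewrite /large ler_piMl // lerBlDr lerDl.
have [W [WS largeW badW stop]] := peeling bad_anti largeS.
exists W; split => // r; apply: le_bigmin => [|v _]; first exact: leey.
rewrite degree_induced lee_fin leNgt; apply/negP => low_v.
set v' := val v in low_v; have vW : v' \in W by exact: valP.
have bad_v : bad W v' by apply/existsP; exists r.
have s0 : 0 < #|S|%:R :> R.
  by rewrite ltr0n card_gt0; apply/set0Pn; exists v'; exact: (subsetP WS).
have n0 : 0 < n%:R :> R by rewrite ltr0n -cardV; apply/card_gt0P; exists v'.
have sD : #|S|%:R * D%:R = C * n%:R * lambda.
  by rewrite S_card -!mulrA mulVf ?mulr1 ?gt_eqF.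
have lam0 : 0 < lambda.
  rewrite -(pmulr_rgt0 lambda (mulr_gt0 C0 n0)) -sD; exact: mulr_gt0.
(* [S] has at most [n] elements, so [C * lambda <= D], and [C > 1]. *)
have lamD : lambda < D%:R.
  have : #|S|%:R <= n%:R :> R by rewrite ler_nat -cardV max_card.
  rewrite -(ler_pM2r D0) sD => H.
  have : C * lambda <= D%:R by rewrite -(ler_pM2l n0) mulrCA mulrA.
  by move: C4 lam0; nra.
set s : R := #|S|%:R in s0 sD *; set q := #|W|%:R / s.
have q_ge : 2^-1 <= q.
  rewrite /q ler_pdivlMr //; apply: le_trans largeW.
  by rewrite -/s ler_wpM2r ?(ltW s0) //; lra.
have wE : #|W|%:R = q * s by rewrite /q divfK // gt_eqF.
(* The average over all vertices of the number of neighbours in [W]. *)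
have densE : D%:R * #|W|%:R / n%:R = C * lambda * q.
  rewrite wE mulrCA [D%:R * s]mulrC sD; field; exact: lt0r_neq0.
(* Removing [W :\ v'] rather than [W] keeps [v'] in [Y] as well as in [W]: this
   makes [Y] larger than [x0 * s] while [W] is still large. *)
pose Y := S :\: (W :\ v').
pose X i := [set u in Y | (degree_in (G i) W u)%:R < theta].
have Y_gt : x0 * s < #|Y|%:R.
  have := stop _ vW bad_v; rewrite /large -ltNge -/s.
  have : (#|W :\ v'| + #|Y|)%:R = s :> R.
    rewrite /s -(cardsID (W :\ v') S) (setIidPr _) //.
    exact: subset_trans (subD1set _ _) WS.
  by rewrite natrD; lra.
have Y_le : #|Y|%:R <= \sum_i #|X i|%:R :> R.
  rewrite -natr_sum ler_nat; apply: cover_card => u uY.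
  have /existsP[i low_u] : bad W u.
    have [->//|uv] := eqVneq u v'; apply: badW.
    by move: uY; rewrite !inE uv.
  by exists i; rewrite inE uY.
have X_le i : C ^+ 2 * (q - 4^-1) ^+ 2 * #|X i|%:R <= q * s.
  have lowX : {in X i, forall u, (degree_in (G i) W u)%:R <= theta}.
    by move=> u; rewrite inE => /andP[_ /ltW].
  have theta_le : theta <= D%:R * #|W|%:R / n%:R.
    by rewrite densE /theta; move: (mulr_gt0 C0 lam0) q_ge; nra.
  have := low_degree_card (G_ndl i) lamD lowX theta_le.
  have -> : D%:R * #|W|%:R / n%:R - theta = lambda * (C * (q - 4^-1)).
    by rewrite densE /theta; ring.
  rewrite exprMn -[X in X <= _ -> _]mulrA ler_pM2l ?exprn_gt0 //.
  by rewrite exprMn wE.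
have sum_le : C ^+ 2 * (q - 4^-1) ^+ 2 * #|Y|%:R <= t%:R * (q * s).
  apply: le_trans (_ : C ^+ 2 * (q - 4^-1) ^+ 2 * \sum_i #|X i|%:R <= _).
    by rewrite ler_wpM2l // mulr_ge0 ?sqr_ge0.
  rewrite mulr_sumr; apply: le_trans (ler_sum _ (fun i _ => X_le i)) _.
  by rewrite sumr_const card_ord mulr_natl.
have q4 : 0 < C ^+ 2 * (q - 4^-1) ^+ 2.
  by rewrite mulr_gt0 // exprn_gt0 //; lra.
have : 8 * (q - 4^-1) ^+ 2 * (t%:R * s) < q * (t%:R * s).
  rewrite [q * _]mulrCA; apply: lt_le_trans sum_le.
  apply: le_lt_trans (_ : _ <= C ^+ 2 * (q - 4^-1) ^+ 2 * (x0 * s)) _.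
    rewrite [leRHS](_ : _ = (x0 * C ^+ 2) * (q - 4^-1) ^+ 2 * s); last ring.
    by rewrite x0E le_eqVlt; apply/orP; left; apply/eqP; ring.
  by rewrite ltr_pM2l.
rewrite ltr_pM2r; last by rewrite mulr_gt0 // (lt_le_trans _ t1).
(* [8 * (q - 1/4)^2 - q = 8 * (q - 1/2) * (q - 1/8)]. *)
by move: q_ge; nra.
Qed.
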